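(* Let $q$ be a power of an odd prime and $k\geq 2$ an integer. Let $\mathcal{C}$ be a $k$-dimensional linear maximum distance separable code over $\mathbb{F}_q$ of length $3k-6$ that can be extended to a (doubly-extended) Reed–Solomon code of length $q+1$. Then $\mathcal{C}$ cannot be extended to a $k$-dimensional linear maximum distance separable code over $\mathbb{F}_q$ of length $q+2$.
   Context: A $k$-dimensional linear code of length $m$ over $\mathbb{F}_q$ is maximum distance separable (MDS) if its minimum distance is $m-k+1$; equivalently, the columns of a $k\times m$ generator matrix form an arc, i.e. any $k$ columns are linearly independent. The (doubly-extended) Reed–Solomon code of length $q+1$ and dimension $k$ is the code with generator matrix whose columns are the vectors $(1,t,t^2,\ldots,t^{k-1})^T$, $t\in\mathbb{F}_q$, together with $(0,\ldots,0,1)^T$. A $k$-dimensional code $\mathcal{C}$ of length $m$ is said to extend to a $k$-dimensional code $\mathcal{C}'$ of length $m'\geq m$ if $\mathcal{C}$ is obtained (up to permutation of coordinates) from $\mathcal{C}'$ by deleting $m'-m$ coordinates, i.e. a generator matrix of $\mathcal{C}$ consists of $m$ of the columns of a generator matrix of $\mathcal{C}'$. *)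

(* Defs.v *)
From HB Require Import structures.
From mathcomp Require Export all_boot all_order all_algebra.

Set Implicit Arguments.
Unset Strict Implicit.
Unset Printing Implicit Defensive.

Import GRing.Theory.
Local Open Scope ring_scope.

Section Codes.
Variable F : finFieldType.

Definition hamming_dist m (u v : 'rV[F]_m) : nat := #|[set i | u 0 i != v 0 i]|.

Definition has_min_dist m (C : {vspace 'rV[F]_m}) (d : nat) : Prop :=
  (exists u v, [/\ u \in C, v \in C, u != v & hamming_dist u v = d]) /\
  (forall u v, u \in C -> v \in C -> u != v -> (d <= hamming_dist u v)%N).

(* The truncated subtraction is harmless: \dim C <= m always holds. *)
Definition MDS m (C : {vspace 'rV[F]_m}) : Prop :=
  has_min_dist C (m - \dim C + 1)%N.

Definition code_of_gen k m (G : 'M[F]_(k, m)) : {vspace 'rV[F]_m} :=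
  <<[seq row i G | i : 'I_k]>>%VS.

(* The injection f lists the coordinates of C' that are kept; f need not be
   monotone, which accounts for permutations of the coordinates. *)
Definition extends_to m m' (C : {vspace 'rV[F]_m}) (C' : {vspace 'rV[F]_m'})
    : Prop :=
  \dim C = \dim C' /\
  exists2 f : 'I_m -> 'I_m', injective f &
    forall u : 'rV[F]_m, u \in C <-> exists2 v, v \in C' & u = colsub f v.

(* Column j < #|F| is (1, t, ..., t^(k-1))^T with t the j-th element of F;
   the last column is (0, ..., 0, 1)^T. *)
Definition RS_gen k : 'M[F]_(k, #|F|.+1) :=
  \matrix_(i, j) if unlift ord_max j is Some s then enum_val s ^+ i
                 else (i.+1 == k)%:R.

Definition RS_code k : {vspace 'rV[F]_(#|F|.+1)} := code_of_gen (RS_gen k).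

End Codes.

Arguments RS_gen F k : clear implicits.
Arguments RS_code F k : clear implicits.

(* Main.v *)
(* Put t = k - 3. A vector of the dual of F^k is a polynomial of size at most k,
   and the columns of a generator matrix of an MDS code of length q + 2 are
   functionals L_u on such polynomials; the ones indexed by the points of the
   normal rational curve G are evaluations. For a set S of k - 2 points of G let
   N_S be the form vanishing on S. The hyperplanes through S form a projective
   line, q + 1 - t points of which contain a further point of the arc; the
   product P_S of the t linear forms of the other ones satisfies, by Wilson's
   theorem on that line and after scaling,
     P_S(y) N_S(y) prod_(u not in S + y) L_u(N_(S + y)) = 1   (y in G \ S).
   The product over u depends only on the set S + y, so for a fixed set D of
   k - 3 points b(x, y) = P_(D + x)(y) / N_D(x) is antisymmetric off the diagonal.
   It has degree at most t in y, and interpolating on two disjoint sets of t + 1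
   points gives 2 b(x, x) = 0. Hence P_S vanishes at the t + 1 points of S, so
   P_S = 0, which contradicts the displayed equation. *)
Require Import Defs.
From mathcomp Require Import all_boot all_order all_algebra all_field.
From mathcomp Require Import ring zify.

Set Implicit Arguments.
Unset Strict Implicit.
Unset Printing Implicit Defensive.

Import GRing.Theory.
Local Open Scope ring_scope.

(** * Binary forms and their values on the projective line *)

Section Forms.
Variable F : finFieldType.
Implicit Types (p q : {poly F}) (x y : option F) (n : nat).

(* [option F] is the projective line, [None] being the point at infinity, and a
   binary form of degree [n] is given by its dehomogenization [p], whose size
   is at most [n.+1]; its value at infinity is the coefficient of degree [n]. *)
Definition pev n p x : F := if x is Some a then p.[a] else p`_n.

(* The sign at infinity makes [bra] below antisymmetric. *)
Definition lin x : {poly F} := if x is Some a then 'X - a%:P else - 1.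

Definition bra x y : F := pev 1 (lin x) y.

Lemma pevZ n c p x : pev n (c *: p) x = c * pev n p x.
Proof. by case: x => [a|] /=; rewrite ?hornerZ ?coefZ. Qed.

Lemma pevM m n p q x : (size p <= m.+1)%N -> (size q <= n.+1)%N ->
  pev (m + n) (p * q) x = pev m p x * pev n q x.
Proof.
case: x => [a|] /= sp sq; first by rewrite hornerM.
have lt_m : (m < (m + n).+1)%N by lia.
rewrite coefM (bigD1 (Ordinal lt_m)) //= big1 ?addr0.
  by rewrite addKn.
move=> i /eqP/val_eqP /= ne_im.
have [lt_mi|le_im] := ltnP m i.
  by rewrite [p`_i]nth_default ?mul0r // (leq_trans sp).
by rewrite [q`_ _]nth_default ?mulr0 // (leq_trans sq) // ltn_subRL ltn_add2r ltn_neqAle ne_im.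
Qed.

Lemma size_lin x : (size (lin x) <= 2)%N.
Proof. by case: x => [a|] /=; rewrite ?size_XsubC // size_polyN size_poly1. Qed.

Lemma lin_neq0 x : lin x != 0.
Proof. by case: x => [a|] /=; rewrite ?polyXsubC_eq0 // oppr_eq0 oner_neq0. Qed.

Lemma braC x y : bra x y = - bra y x.
Proof.
case: x => [a|]; case: y => [b|] /=;
  rewrite /bra /= ?coefB ?coefX ?coefN ?coefC.
- by rewrite !hornerE opprB.
- by rewrite !hornerE /= subr0 opprK.
- by rewrite !hornerE /= subr0.
- by rewrite /= !oppr0.
Qed.

Lemma bra_eq0 x y : (bra x y == 0) = (x == y).
Proof.
case: x => [a|]; case: y => [b|] /=;
  rewrite /bra /= ?coefB ?coefX ?coefN ?coefC.
- by rewrite !hornerE subr_eq0 eq_sym.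
- by rewrite /= subr0 oner_eq0.
- by rewrite !hornerE oppr_eq0 oner_eq0.
- by rewrite /= oppr0 !eqxx.
Qed.

Lemma size_prod_lin (r : seq (option F)) :
  (size (\prod_(x <- r) lin x)%R <= (size r).+1)%N.
Proof.
elim: r => [|x r IHr]; first by rewrite big_nil size_poly1.
rewrite big_cons /=; apply: leq_trans (size_polyMleq _ _) _.
by rewrite -subn1 leq_subLR (leq_trans (leq_add (size_lin x) IHr)) ?addnS.
Qed.

Lemma pev_prod_lin (r : seq (option F)) y :
  pev (size r) (\prod_(x <- r) lin x) y = \prod_(x <- r) bra x y.
Proof.
elim: r => [|x r IHr].
  by rewrite !big_nil; case: y => [a|] /=; rewrite ?hornerE // coef1.
by rewrite !big_cons /= -add1n pevM ?IHr ?size_lin ?size_prod_lin.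
Qed.

Lemma size_prodset_lin (I : finType) (S : {set I}) (f : I -> option F) :
  (size (\prod_(i in S) lin (f i))%R <= #|S|.+1)%N.
Proof.
rewrite -big_enum -(big_map f predT lin) cardE -(size_map f).
exact: size_prod_lin.
Qed.

Lemma pev_prodset_lin (I : finType) (S : {set I}) (f : I -> option F) y :
  pev #|S| (\prod_(i in S) lin (f i)) y = \prod_(i in S) bra (f i) y.
Proof.
rewrite -!big_enum -(big_map f predT lin) -(big_map f predT (bra^~ y)).
by rewrite cardE -(size_map f); exact: pev_prod_lin.
Qed.

(** A zero at infinity kills the top coefficient and lowers the degree bound by one, so the
    remaining affine zeros still outnumber the degree. *)
Lemma pev_roots n p (r : seq (option F)) : (size p <= n.+1)%N ->
  uniq r -> (n < size r)%N -> {in r, forall x, pev n p x = 0} -> p = 0.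
Proof.
move=> sp Ur ltnr p0.
have Up : uniq (pmap id r) by apply: pmap_uniq Ur => -[].
have p0' : all (root p) (pmap id r).
  apply/allP=> a; rewrite mem_pmap map_id => ar.
  by apply/rootP; apply: (p0 (Some a) ar).
apply/eqP; apply: contraT => pn0.
have := max_poly_roots pn0 p0' Up.
have size_r : size r = (size (pmap id r) + (None \in r))%N.
  rewrite size_pmap -(count_predC isSome); congr (_ + _)%N.
  by rewrite -(count_uniq_mem None Ur); apply: eq_count => -[].
case: (boolP (None \in r)) size_r => [Nr|_] size_r; last first.
  by rewrite addn0 in size_r; rewrite ltnNge -size_r (leq_trans sp).
have pn : p`_n = 0 by apply: (p0 None Nr).
have : (size p <= n)%N.
  apply/leq_sizeP => j; rewrite leq_eqVlt => /predU1P[<- //|lt_nj].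
  by rewrite nth_default //; apply: leq_trans lt_nj.
rewrite addn1 in size_r.
by move=> spn /leq_trans/(_ spn); rewrite ltnNge -ltnS -size_r ltnr.
Qed.

(** The matrix [E] of monomial values at the nodes is invertible, because a form of degree [n] with
    [n + 1] zeros is zero; [a] solves the system expressing the values at [x]. *)
Lemma pev_interpolation n (z : 'I_n.+1 -> option F) x : injective z ->
  exists a : 'I_n.+1 -> F, forall p, (size p <= n.+1)%N ->
    pev n p x = \sum_i a i * pev n p (z i).
Proof.
move=> z_inj.
have pevE p y : (size p <= n.+1)%N ->
    pev n p y = \sum_(i < n.+1) p`_i * pev n 'X^i y.
  move=> sp; case: y => [b|] /=.
    by rewrite (horner_coef_wide _ sp); apply: eq_bigr => i _; rewrite hornerXn.
  rewrite (bigD1 ord_max) //= coefXn eqxx mulr1 big1 ?addr0 // => i ne_i.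
  by rewrite coefXn eq_sym (negPf ne_i : (i == n :> nat) = false) mulr0.
pose E := \matrix_(i, j < n.+1) pev n 'X^i (z j).
have Eu : E \in unitmx.
  rewrite -row_free_unit; apply: inj_row_free => v vE0.
  suff rv0 : rVpoly v = 0.
    by apply/rowP => i; rewrite mxE -coef_rVpoly_ord rv0 coef0.
  have sv : (size (rVpoly v) <= n.+1)%N by apply: size_poly.
  apply: (pev_roots (r := codom z) sv).
  - by rewrite map_inj_uniq ?enum_uniq.
  - by rewrite size_codom card_ord.
  move=> _ /codomP[j ->]; rewrite pevE //.
  have /rowP/(_ j) := vE0; rewrite !mxE => vEj; rewrite -[RHS]vEj.
  by apply: eq_bigr => i _; rewrite coef_rVpoly_ord mxE.
have [a Ea] : exists a, E *m a = \col_i pev n 'X^i x.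
  by exists (invmx E *m \col_i pev n 'X^i x); rewrite mulKVmx.
exists (fun j => a j 0) => p sp; rewrite pevE //.
under [RHS]eq_bigr => j _ do rewrite pevE // mulr_sumr.
rewrite exchange_big /=; apply: eq_bigr => i _.
have /colP/(_ i) := Ea; rewrite !mxE => <-; rewrite mulr_sumr; apply: eq_bigr => j _.
by rewrite [E i j]mxE; ring.
Qed.

(** Wilson's theorem for [F]: factor [X^q - X], cancel [X] and evaluate at 0. *)
Lemma prod_nonzero : \prod_(a : F | a != 0) a = -1.
Proof.
have := finField_genPoly F; rewrite (bigD1 0) //= subr0.
rewrite -(prednK (ltnW (finNzRing_gt1 F))) exprS -{3}['X]mulr1 -mulrBr.
move/(mulfI (negbT (polyX_eq0 F)))/(congr1 (horner^~ 0)).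
rewrite !hornerE expr0n horner_prod -subn1 subn_eq0 leqNgt finNzRing_gt1 /=.
rewrite sub0r => ->.
rewrite (reindex_inj oppr_inj) /=; apply: eq_big => [a|a _].
  by rewrite oppr_eq0.
by rewrite !hornerE.
Qed.

(** Wilson's theorem on the projective line. For affine [x] a translation reduces it to
    [prod_nonzero]; for [x] at infinity it is [(-1)^q = -1], as the [q]-th power map is the identity
    of [F]. *)
Lemma prod_bra x : \prod_(y | y != x) bra x y = -1.
Proof.
case: x => [a|].
  rewrite (bigD1 None) //= {1}/bra /= coefB coefX coefC /= subr0 mul1r.
  rewrite -prod_nonzero (reindex_onto Some (odflt a)) /=; last by case.
  rewrite [RHS](reindex_inj (addIr (- a))) /=; apply: eq_big => [b|b _].
    by rewrite !andbT eqxx andbT subr_eq0.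
  by rewrite /bra /= !hornerE.
rewrite (reindex_onto Some (odflt 0)) /=; last by case.
under eq_bigl do rewrite eqxx.
under eq_bigr do rewrite hornerN hornerC.
by rewrite prodr_const /= expf_card.
Qed.

(** The point is [a1 / a0], or infinity when [a0 = 0]. *)
Lemma functional_pev (a0 a1 : F) : exists x (c : F),
  forall p, (size p <= 2)%N -> p`_0 * a0 + p`_1 * a1 = c * pev 1 p x.
Proof.
have [->|a0n] := eqVneq a0 0.
  by exists None, a1 => p _; rewrite mulr0 add0r mulrC.
exists (Some (a1 / a0)), a0 => p sp /=.
rewrite (horner_coef_wide _ sp) !big_ord_recl big_ord0 /=.
by field.
Qed.

(* With [b u v = c u * pev n (P u) (e v)], writing evaluation at [e x0] as a
   combination of evaluations at the [e (y i)], and then of evaluations at the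
   [e (z j)], yields [b x0 x0 = - b x0 x0]. *)
Lemma antisymmetric_diag0 n (T : Type) (P : T -> {poly F}) (e : T -> option F)
    (c : T -> F) (x0 : T) (y z : 'I_n.+1 -> T) :
  2%:R != 0 :> F ->
  (forall u, size (P u) <= n.+1)%N ->
  injective (e \o y) -> injective (e \o z) ->
  (forall i, c x0 * pev n (P x0) (e (y i)) = - (c (y i) * pev n (P (y i)) (e x0))) ->
  (forall i, c x0 * pev n (P x0) (e (z i)) = - (c (z i) * pev n (P (z i)) (e x0))) ->
  (forall i j, c (y i) * pev n (P (y i)) (e (z j)) =
             - (c (z j) * pev n (P (z j)) (e (y i)))) ->
  c x0 * pev n (P x0) (e x0) = 0.
Proof.
move=> two_neq0 sP y_inj z_inj Hy Hz Hyz.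
have [a Ha] := pev_interpolation (e x0) y_inj.
have [b Hb] := pev_interpolation (e x0) z_inj.
pose w := c x0 * pev n (P x0) (e x0).
have wE : w = - w.
  rewrite {1}/w Ha // mulr_sumr.
  transitivity (- \sum_i \sum_j a i * b j * (c (y i) * pev n (P (y i)) (e (z j)))).
    rewrite -sumrN; apply: eq_bigr => i _; rewrite mulrCA Hy mulrN; congr (- _).
    rewrite Hb // !mulr_sumr; apply: eq_bigr => j _ /=; ring.
  congr (- _); rewrite /w Hb // mulr_sumr exchange_big; apply: eq_bigr => j _.
  rewrite [RHS]mulrCA Hz Ha // mulr_sumr -sumrN mulr_sumr.
  apply: eq_bigr => i _; rewrite Hyz /=; ring.
apply/eqP; have : 2%:R * w == 0 by rewrite mulr_natl mulr2n {1}wE addNr.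
by rewrite mulf_eq0 (negPf two_neq0).
Qed.
End Forms.

(** * Arcs of size [q + 2] sharing points with the normal rational curve *)

Section Arc.
Variables (F : finFieldType) (A J : finType) (t : nat).
Variables (L : A -> {poly F} -> F) (g : J -> A) (pt : J -> option F).
Implicit Types (p q : {poly F}) (S D : {set J}) (u v : A).

Hypothesis LD : forall u p q, L u (p + q) = L u p + L u q.
Hypothesis LZ : forall u c p, L u (c *: p) = c * L u p.
Hypothesis L_arc : forall p, (size p <= t.+3)%N -> p != 0 ->
  (#|[set u | L u p == 0%R]| < t.+3)%N.
Hypothesis card_A : #|A| = (#|F| + 2)%N.
Hypothesis card_J : (t.+2 < #|J|)%N.
Hypothesis g_inj : injective g.
Hypothesis pt_inj : injective pt.
Hypothesis L_curve : forall j p, (size p <= t.+3)%N ->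
  L (g j) p = pev t.+2 p (pt j).

Let N (S : {set J}) : {poly F} := \prod_(i in S) lin (pt i).

(** Otherwise the nonzero form [N S * p] would vanish at [t + 3] arc points: those of [S], [u] and
    [v]. *)
Lemma pencil_eq0 S u v p : #|S| = t.+1 ->
  u \notin g @: S -> v \notin g @: S -> u != v -> (size p <= 2)%N ->
  L u (N S * p) = 0 -> L v (N S * p) = 0 -> p = 0.
Proof.
move=> cS uS vS ne_uv sp Lu Lv; apply/eqP; apply: contraT => pn0.
have sN : (size (N S) <= t.+2)%N by rewrite -cS; apply: size_prodset_lin.
have sNp : (size (N S * p)%R <= t.+3)%N.
  apply: leq_trans (size_polyMleq _ _) _.
  by rewrite -subn1 leq_subLR (leq_trans (leq_add sN sp)) // addn2.
have Nn0 : N S != 0 by apply/prodf_neq0 => i _; apply: lin_neq0.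
have := L_arc sNp (mulf_neq0 Nn0 pn0); rewrite ltnNge => /negP[].
have <- : #|u |: (v |: g @: S)| = t.+3.
  by rewrite !cardsU1 !inE negb_or ne_uv uS vS card_imset ?cS.
apply/subset_leq_card/subsetP => w; rewrite !inE.
case/or3P => [/eqP->|/eqP->|/imsetP[j jS ->]]; rewrite ?Lu ?Lv //.
rewrite L_curve // -[t.+2]addn1 pevM // /N -cS pev_prodset_lin.
have b0 : bra (pt j) (pt j) = 0 by apply/eqP; rewrite bra_eq0.
by rewrite (bigD1 j) //= b0 !mul0r.
Qed.

(** For [u] outside [S], [dc.1] locates on the pencil of hyperplanes through [S] the one that
    contains [u]. *)
Lemma pencil_functional S u : exists dc : option F * F,
  forall p, (size p <= 2)%N -> L u (N S * p) = dc.2 * pev 1 p dc.1.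
Proof.
have [x [c H]] := functional_pev (L u (N S)) (L u (N S * 'X)).
exists (x, c) => p sp; rewrite -H // -!LZ -LD; congr (L u _).
have {1}-> : p = p`_0 *: 1 + p`_1 *: 'X.
  apply/polyP => -[|[|i]]; rewrite !coefE ?mulr1 ?mulr0 ?addr0 ?add0r //.
  by rewrite nth_default // (leq_trans sp).
by rewrite mulrDr -!scalerAr mulr1.
Qed.

(* The [t] hyperplanes meeting the arc exactly in [S] are given by polynomials
   [N S * lin x]; up to a scalar, [P] is the product of these [lin x]. *)
Lemma tangent_form S : exists P : {poly F},
  (size P <= t.+1)%N /\ (#|S| = t.+1 -> forall y, y \notin S ->
    pev t P (pt y) * \prod_(i in S) bra (pt i) (pt y) *
      \prod_(u | u \notin g @: (y |: S)) L u (N (y |: S)) = 1).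
Proof.
have [cS|ncS] := eqVneq #|S| t.+1; last first.
  (* A dummy value, so that [P] can later be chosen for all sets at once. *)
  by exists 0; split; [rewrite size_poly0 | move/eqP; rewrite (negPf ncS)].
have [dc dcE] := fin_all_exists (pencil_functional S).
pose d u := (dc u).1; pose c u := (dc u).2.
have {dcE}LE u p : (size p <= 2)%N -> L u (N S * p) = c u * pev 1 p (d u).
  exact: dcE.
pose I := ~: g @: S.
have b0 x : pev 1 (lin x) x = 0 :> F by apply/eqP; rewrite -/(bra x x) bra_eq0.
have d_inj : {in I &, injective d}.
  move=> u v; rewrite !inE => uI vI duv; apply/eqP; apply: contraT => ne_uv.
  have := pencil_eq0 cS uI vI ne_uv (size_lin (d u)).
  rewrite !LE ?size_lin // -duv b0 !mulr0 => /(_ erefl erefl)/eqP.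
  by rewrite (negPf (lin_neq0 _)).
(* If [c u = 0], all hyperplanes of the pencil contain [u], including the one through another curve
   point [g j] outside [S]. *)
have c_neq0 u : u \in I -> c u != 0.
  rewrite inE => uI; have : (1 < #|~: S|)%N by move: card_J; rewrite -(cardsC S) cS; lia.
  case/card_gt1P => j1 [j2 [+ + ne_j]]; rewrite !inE => j1S j2S.
  have [j [jS ne_ju]] : exists j, j \notin S /\ u != g j.
    case: (eqVneq u (g j1)) => [->|]; last by exists j1.
    by exists j2; rewrite (inj_eq g_inj).
  have gjS : g j \notin g @: S by rewrite mem_imset.
  apply/eqP => cu0.
  have := pencil_eq0 cS uI gjS ne_ju (size_lin (d (g j))).
  rewrite !LE ?size_lin // b0 cu0 mulr0 mul0r => /(_ erefl erefl)/eqP.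
  by rewrite (negPf (lin_neq0 _)).
(* The pencil has [q + 1] members, and [q + 2 - (t + 1)] of them meet the arc outside [S]; this
   leaves [t]. *)
have card_I : (#|I| + t = #|F|.+1)%N.
  by have := cardsC (g @: S); rewrite card_A card_imset // cS /I; lia.
have card_dI : #|~: d @: I| = t.
  by rewrite [LHS]cardsCs setCK card_option card_in_imset // -card_I addKn.
pose T := \prod_(x in ~: d @: I) lin x.
have sT : (size T <= t.+1)%N by rewrite -card_dI; apply: size_prodset_lin.
(* [(-1) ^+ t] comes from reversing the brackets in [T], the final [-1] from Wilson's theorem. *)
pose K := (-1) ^+ t * (\prod_(u in I) c u) * (-1).
have K_neq0 : K != 0.
  rewrite !mulf_neq0 ?expf_neq0 ?oppr_eq0 ?oner_neq0 //.
  by apply/prodf_neq0 => u; apply: c_neq0.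
exists (K^-1 *: T); split=> [|_ y yS]; first exact: leq_trans (size_scale_leq _ _) sT.
have gyI : g y \in I by rewrite inE mem_imset.
have sN : (size (N S) <= t.+2)%N by rewrite -cS; apply: size_prodset_lin.
have LgyE p : (size p <= 2)%N ->
    c (g y) * pev 1 p (d (g y)) = (\prod_(i in S) bra (pt i) (pt y)) * pev 1 p (pt y).
  move=> sp; rewrite -LE // L_curve; last first.
    apply: leq_trans (size_polyMleq _ _) _.
    by rewrite -subn1 leq_subLR (leq_trans (leq_add sN sp)) // addn2.
  by rewrite -[t.+2]addn1 pevM // /N -cS pev_prodset_lin.
have dgy : d (g y) = pt y.
  apply/eqP; have /eqP := LgyE _ (size_lin (pt y)).
  rewrite b0 mulr0 mulf_eq0 (negPf (c_neq0 _ gyI)) -/(bra _ _) bra_eq0.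
  by rewrite eq_sym.
have cgy : \prod_(i in S) bra (pt i) (pt y) = c (g y).
  pose x := if pt y is None then Some 0 : option F else None.
  have bn0 : bra x (pt y) != 0 by rewrite bra_eq0 /x; case: (pt y).
  by apply: (mulIf bn0); rewrite -(LgyE _ (size_lin x)) dgy.
rewrite cgy pevZ -!mulrA; apply: (canLR (mulKf K_neq0)); rewrite mulr1.
(* The product over [u] omits [g y]; the product of brackets over [S], equal to [c (g y)], supplies
   the missing scalar. *)
transitivity (pev t T (pt y) * (c (g y) *
    \prod_(u in I :\ g y) (c u * bra (pt y) (d u)))).
  congr (_ * (_ * _)); apply: eq_big => [u|u].
    by rewrite imsetU1 !inE negb_or.
  rewrite imsetU1 !inE negb_or => /andP[_ uS].
  by rewrite /N big_setU1 //= mulrC -/(N S) LE ?size_lin.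
rewrite big_split /= mulrA mulrA -[_ * c _ * _]mulrA -(big_setD1 _ gyI) /=.
rewrite /T -card_dI pev_prodset_lin.
under eq_bigr do rewrite braC -mulN1r.
rewrite big_split /= prodr_const card_dI /K.
(* Since [d (g y) = pt y], the points other than [pt y] are the [t] missed ones and the [d u] for
   the other [u] in [I]. *)
have <- : \prod_(x in ~: d @: I) bra (pt y) x *
    \prod_(u in I :\ g y) bra (pt y) (d u) = -1; last by ring.
rewrite -(prod_bra (pt y)) [RHS](bigID (mem (d @: I))) mulrC; congr (_ * _).
  have d_injy : {in I :\ g y &, injective d}.
    by apply: sub_in2 d_inj => u; rewrite in_setD1 => /andP[].
  rewrite -(big_imset (bra (pt y)) d_injy); apply: eq_bigl => x /=.
  apply/imsetP/andP => [[u /setD1P[ne_u uI] ->]|[ne_x /imsetP[u uI xE]]].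
    by rewrite imset_f // -dgy (inj_in_eq d_inj).
  exists u; rewrite // in_setD1 uI andbT; apply: contraNneq ne_x => uE.
  by rewrite xE uE dgy.
apply: eq_bigl => x; rewrite inE andb_idl //; apply: contraNneq => ->.
by rewrite -dgy; apply: imset_f.
Qed.

(** [s] enumerates the set [S]; [y] and [z] are the two disjoint sets of interpolation nodes. *)
Lemma curve_arc_absurd (s y z : 'I_t.+1 -> J) : 2%:R != 0 :> F ->
  injective s -> injective y -> injective z ->
  (forall i j, s i != y j) -> (forall i j, s i != z j) ->
  (forall i j, y i != z j) -> False.
Proof.
move=> two_neq0 s_inj y_inj z_inj ne_sy ne_sz ne_yz.
have [P PE] := fin_all_exists tangent_form.
(* Both uses of [tangent_form] lead to the set [D] with [a] and [b] added, so they share the product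
   over [u]; the sign is that of [braC]. *)
have antisym D a b : #|D| = t -> a \notin D -> b \notin D -> a != b ->
    (\prod_(i in D) bra (pt i) (pt a))^-1 * pev t (P (a |: D)) (pt b) =
    - ((\prod_(i in D) bra (pt i) (pt b))^-1 * pev t (P (b |: D)) (pt a)).
  move=> cD aD bD ne_ab.
  have n_neq0 c : c \notin D -> \prod_(i in D) bra (pt i) (pt c) != 0.
    move=> cND; apply/prodf_neq0 => i iD; rewrite bra_eq0 (inj_eq pt_inj).
    by apply: contraNneq cND => <-.
  have card1 c : c \notin D -> #|c |: D| = t.+1 by rewrite cardsU1 cD => ->.
  have Ea := (PE (a |: D)).2 (card1 a aD) b.
  have Eb := (PE (b |: D)).2 (card1 b bD) a.
  rewrite !inE !negb_or eq_sym ne_ab bD in Ea; have {Ea} := Ea isT.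
  rewrite !inE !negb_or ne_ab aD in Eb; have {Eb} := Eb isT.
  rewrite [a |: (b |: D)]setUCA !big_setU1 //= (braC (pt b) (pt a)).
  set f := \prod_(u | _) L u _; set w := bra _ _.
  set n := \prod_(i in D) bra (pt i) (pt b).
  set m := \prod_(i in D) bra (pt i) (pt a).
  set v := pev _ _ (pt b); set v' := pev _ _ (pt a) => Ev' Ev.
  have w_neq0 : w != 0 by rewrite bra_eq0 (inj_eq pt_inj).
  have f_neq0 : f != 0.
    by apply: contra_eqN Ev => /eqP->; rewrite mulr0 eq_sym oner_eq0.
  have [n0 m0] : n != 0 /\ m != 0 by split; apply: n_neq0.
  have -> : v = (w * n * f)^-1.
    by rewrite -[LHS](mulfK (mulf_neq0 (mulf_neq0 w_neq0 n0) f_neq0)) mulrA Ev mul1r.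
  have -> : v' = - (w * m * f)^-1.
    rewrite -[LHS](mulfK (mulf_neq0 (mulf_neq0 w_neq0 m0) f_neq0)).
    have -> : v' * (w * m * f) = - (v' * (- w * m) * f) by ring.
    by rewrite Ev' mulN1r.
  by field; rewrite w_neq0 f_neq0 n0 m0.
pose S := s @: 'I_t.+1.
have cS : #|S| = t.+1 by rewrite card_imset ?card_ord.
have yS i : y i \notin S.
  by apply/imsetP => -[j _ /esym/eqP]; rewrite (negPf (ne_sy j i)).
have zS i : z i \notin S.
  by apply/imsetP => -[j _ /esym/eqP]; rewrite (negPf (ne_sz j i)).
have PS0 : P S = 0.
  apply: (pev_roots (n := t) (r := [seq pt (s i) | i : 'I_t.+1])).
  - by have [] := PE S.
  - by rewrite map_inj_uniq ?enum_uniq //; apply: inj_comp.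
  - by rewrite size_map size_enum_ord.
  move=> _ /mapP[i _ ->].
  have siS : s i \in S by apply: imset_f.
  pose D := S :\ s i.
  have cD : #|D| = t by have := cardsD1 (s i) S; rewrite siS cS => -[].
  have DE : s i |: D = S by rewrite setD1K.
  have siD : s i \notin D by rewrite !inE eqxx.
  have yD j : y j \notin D by rewrite !inE negb_and yS orbT.
  have zD j : z j \notin D by rewrite !inE negb_and zS orbT.
  have /eqP := @antisymmetric_diag0 F t J (fun a => P (a |: D)) pt
    (fun a => (\prod_(i in D) bra (pt i) (pt a))^-1) (s i) y z two_neq0
    (fun a => (PE (a |: D)).1) (inj_comp pt_inj y_inj) (inj_comp pt_inj z_inj)
    (fun j => antisym D _ _ cD siD (yD j) (ne_sy i j))
    (fun j => antisym D _ _ cD siD (zD j) (ne_sz i j))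
    (fun j k => antisym D _ _ cD (yD j) (zD k) (ne_yz j k)).
  rewrite DE mulf_eq0 invr_eq0 => /orP[|/eqP //].
  rewrite prodf_seq_eq0 => /hasP[j _ /andP[jD]].
  by rewrite bra_eq0 (inj_eq pt_inj) => /eqP jE; rewrite jE (negPf siD) in jD.
have := (PE S).2 cS (y ord0) (yS ord0); rewrite PS0 => /eqP.
have -> : pev t 0 (pt (y ord0)) = 0 :> F.
  by case: (pt _) => [a|] /=; rewrite ?horner0 ?coef0.
by rewrite !mul0r eq_sym oner_eq0.
Qed.
End Arc.

(** * From codes to arcs *)

Lemma RS_gen_horner (F : finFieldType) n (j : 'I_(#|F|.+1)) (p : {poly F}) :
  (size p <= n.+1)%N ->
  \sum_(i < n.+1) p`_i * RS_gen F n.+1 i j =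
    pev n p (omap enum_val (unlift ord_max j)).
Proof.
move=> sp; under eq_bigr do rewrite mxE.
case: (unlift ord_max j) => [a|] /=; first by rewrite (horner_coef_wide _ sp).
rewrite (bigD1 ord_max) //= eqxx mulr1 big1 ?addr0 // => i ne_i.
by rewrite eqSS (negPf ne_i : (i == n :> nat) = false) mulr0.
Qed.

(** So many zeros leave a weight of at most [m - \dim C], below the minimum distance. *)
Lemma MDS_eq0 (F : finFieldType) m (C : {vspace 'rV[F]_m}) (w : 'rV[F]_m) :
  MDS C -> w \in C -> (\dim C <= #|[set u | w 0 u == 0]%R|)%N -> w = 0.
Proof.
move=> [_ minC] wC zw; apply/eqP; apply: contraT => w_neq0.
have := minC w 0 wC (mem0v C) w_neq0.
have -> : hamming_dist w 0 = (m - #|[set u | w 0 u == 0]%R|)%N.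
  rewrite /hamming_dist cardsCs card_ord; congr (_ - #|pred_of_set _|)%N.
  by apply/setP => u; rewrite !inE mxE negbK.
by have := max_card [set u | w 0 u == 0%R]; rewrite card_ord; lia.
Qed.

Theorem theorem1p5 (p e : nat) (F : finFieldType) (k : nat)
    (C : {vspace 'rV[F]_(3 * k - 6)}) :
  prime p -> odd p -> (0 < e)%N -> #|F| = (p ^ e)%N ->
  (2 <= k)%N ->
  \dim C = k -> MDS C -> extends_to C (RS_code F k) ->
  ~ exists C' : {vspace 'rV[F]_(#|F| + 2)},
      [/\ \dim C' = k, MDS C' & extends_to C C'].
Proof.
case: k C => [|[|[|t]]] C p_pr p_odd _ cardF // _ dimC.
  (* For [k = 2] the length is 0, which excludes dimension 2. *)
  by have := dimvS (subvf C); rewrite dimC dimvf /dim /= muln0.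
move=> _ [_ [h h_inj hC]].
move=> [C' [dimC' mdsC' [_ [g g_inj gC]]]].
have two_neq0 : 2%:R != 0 :> F.
  have /pcharf0 p0 := card_finPcharP cardF p_pr.
  apply/eqP => two0; have := oner_neq0 F; rewrite -p0 -(odd_double_half p) p_odd.
  by rewrite natrD -mul2n natrM two0 mul0r addr0 eqxx.
(* Lifting the restricted Reed-Solomon rows to [C'] makes the column at [g j] the curve point
   [pt j]. *)
have lift_row i : exists v : 'rV[F]_(#|F| + 2),
    v \in C' /\ colsub g v = colsub h (row i (RS_gen F t.+3)).
  have /gC[v vC' ->] : colsub h (row i (RS_gen F t.+3)) \in C.
    apply/hC; exists (row i (RS_gen F t.+3)) => //; apply: memv_span.
    by apply/mapP; exists i; rewrite ?mem_enum.
  by exists v.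
have [m mP] := fin_all_exists lift_row.
pose L (u : 'I_(#|F| + 2)) (q : {poly F}) := \sum_(i < t.+3) q`_i * m i 0 u.
pose pt (j : 'I_(3 * t.+3 - 6)) := omap enum_val (unlift ord_max (h j)) : option F.
have pt_inj : injective pt.
  move=> i j; rewrite /pt => ptE; apply: h_inj.
  case: unliftP ptE => [a ->|->]; case: unliftP => [b ->|->] //= [].
  by move/enum_val_inj ->.
have L_curve j (q : {poly F}) : (size q <= t.+3)%N -> L (g j) q = pev t.+2 q (pt j).
  move=> sq; rewrite -RS_gen_horner //; apply: eq_bigr => i _; congr (_ * _).
  by have [_ /rowP/(_ j)] := mP i; rewrite !mxE.
(* With [t + 3] zeros the codeword [w] of [C'] is 0, so [q], of degree at most [t + 2], vanishes at
   all [3t + 3] curve points. *)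
have L_arc (q : {poly F}) : (size q <= t.+3)%N -> q != 0 ->
    (#|[set u | L u q == 0%R]| < t.+3)%N.
  move=> sq q_neq0; rewrite ltnNge; apply: contra_neqN q_neq0 => zq.
  pose w := \sum_(i < t.+3) q`_i *: m i.
  have wE u : w 0 u = L u q.
    by rewrite /w summxE; apply: eq_bigr => i _; rewrite mxE.
  have w0 : w = 0.
    apply: (MDS_eq0 mdsC').
      by apply: memv_suml => i _; apply: memvZ; have [] := mP i.
    by rewrite dimC'; under eq_finset do rewrite wE.
  apply: (@pev_roots F t.+2 q [seq pt j | j : 'I_(3 * t.+3 - 6)] sq).
  - by rewrite map_inj_uniq ?enum_uniq.
  - by rewrite size_map size_enum_ord; lia.
  by move=> _ /mapP[j _ ->]; rewrite -L_curve // -wE w0 mxE.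
(* As [3k - 6 = 3(t + 1)], the coordinates of [C] split into three blocks of length [t + 1]. *)
have lt0 (i : 'I_t.+1) : (i < 3 * t.+3 - 6)%N by have := ltn_ord i; lia.
have lt1 (i : 'I_t.+1) : (t.+1 + i < 3 * t.+3 - 6)%N by have := ltn_ord i; lia.
have lt2 (i : 'I_t.+1) : (t.+1 + (t.+1 + i) < 3 * t.+3 - 6)%N.
  by have := ltn_ord i; lia.
apply: (@curve_arc_absurd F _ _ t L g pt _ _ L_arc _ _ g_inj pt_inj L_curve
  (fun i => Ordinal (lt0 i)) (fun i => Ordinal (lt1 i))
  (fun i => Ordinal (lt2 i)) two_neq0).
- move=> u q r; rewrite /L -big_split; apply: eq_bigr => i _.
  by rewrite coefD mulrDl.
- move=> u c q; rewrite /L mulr_sumr; apply: eq_bigr => i _.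
  by rewrite coefZ mulrA.
- by rewrite card_ord.
- by rewrite card_ord; lia.
- by move=> i j [] /val_inj.
- by move=> i j [] /addnI/val_inj.
- by move=> i j [] /addnI/addnI/val_inj.
all: by move=> i j; rewrite -val_eqE /=; have := ltn_ord i; have := ltn_ord j; lia.
Qed.
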